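(* Let $\lambda\in\mathbb{R}$. For all $m,k\in\mathbb{Z}$ with $k\ge m\ge 0$, $$S_{1,\lambda}(k+1,m+1)=\sum_{l=m}^{k}(-1)^{k-l}\big(k-(m+1)\lambda\big)_{k-l}S_{1,\lambda}(l,m).$$
   Context: For $\lambda\in\mathbb{R}$, the generalized falling factorials are $(x)_{0,\lambda}=1$, $(x)_{n,\lambda}=x(x-\lambda)\cdots(x-(n-1)\lambda)$ for $n\ge 1$, and the ordinary falling factorials (one subscript) are $(x)_{0}=1$, $(x)_{n}=x(x-1)\cdots(x-n+1)$ for $n\ge 1$. The degenerate Stirling numbers of the first kind $S_{1,\lambda}(n,k)$, $0\le k\le n$, are defined by the polynomial identity $(x)_{n}=\sum_{k=0}^{n}S_{1,\lambda}(n,k)(x)_{k,\lambda}$ for $n\ge 0$. *)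

(* Defs.v *)
From HB Require Import structures.
From mathcomp Require Import all_boot all_order all_algebra.
From mathcomp Require Import reals.

Set Implicit Arguments.
Unset Strict Implicit.
Unset Printing Implicit Defensive.

Import Order.TTheory GRing.Theory Num.Theory.
Local Open Scope ring_scope.

(* The two factorials are defined in an arbitrary commutative ring, so that they
   can be read both as polynomials (x := 'X) and as ring elements. *)
Definition falling (A : comNzRingType) (x : A) (n : nat) : A :=
  \prod_(i < n) (x - i%:R).

Definition gen_falling (A : comNzRingType) (lambda x : A) (n : nat) : A :=
  \prod_(i < n) (x - i%:R * lambda).

Section DegenerateStirling1.
Variables (R : comNzRingType) (lambda : R).
Implicit Types (n k : nat).

Local Notation gfX k := (gen_falling lambda%:P ('X : {poly R}) k).

Lemma gen_falling_polyE k : gfX k = \prod_(i < k) ('X - (i%:R * lambda)%:P).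
Proof. by apply: eq_bigr => i _; rewrite polyCM polyC_natr. Qed.

Lemma falling_polyE k :
  falling ('X : {poly R}) k = \prod_(i < k) ('X - (i%:R)%:P).
Proof. by apply: eq_bigr => i _; rewrite polyC_natr. Qed.

Lemma size_gen_falling k : size (gfX k) = k.+1.
Proof.
by rewrite gen_falling_polyE size_prod_XsubC /index_enum -enumT size_enum_ord.
Qed.

Lemma size_falling k : size (falling ('X : {poly R}) k) = k.+1.
Proof.
by rewrite falling_polyE size_prod_XsubC /index_enum -enumT size_enum_ord.
Qed.

Lemma gen_falling_monic k : gfX k \is monic.
Proof. by rewrite gen_falling_polyE monic_prod_XsubC. Qed.

Lemma size_gen_falling_sum n (c : nat -> R) :
  (size (\sum_(k < n) c k *: gfX k)%R <= n)%N.
Proof.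
apply: (leq_trans (size_sum _ _ _)); apply/bigmax_leqP => i _.
by apply: (leq_trans (size_scale_leq _ _)); rewrite size_gen_falling.
Qed.

Lemma gen_falling_span n (p : {poly R}) : (size p <= n)%N ->
  exists c : nat -> R, p = \sum_(k < n) c k *: gfX k.
Proof.
elim: n p => [|n IHn] p sz_p.
  exists (fun=> 0); rewrite big_ord0; apply/eqP.
  by rewrite -size_poly_eq0 -leqn0.
have gn : (gfX n)`_n = 1.
  by have /monicP := gen_falling_monic n; rewrite /lead_coef size_gen_falling.
have sz_q : (size (p - p`_n *: gfX n)%R <= n)%N.
  apply/leq_sizeP => j le_nj; rewrite coefB coefZ.
  move: le_nj; rewrite leq_eqVlt => /predU1P[<-|lt_nj].
    by rewrite gn mulr1 subrr.
  rewrite [p`_j]nth_default ?(leq_trans sz_p) //.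
  by rewrite [(gfX n)`_j]nth_default ?size_gen_falling // mulr0 subrr.
have [c def_q] := IHn _ sz_q.
exists (fun k => if k == n then p`_n else c k).
rewrite big_ord_recr /= eqxx -[LHS](subrK (p`_n *: gfX n)) def_q.
by congr (_ + _); apply: eq_bigr => i _; rewrite ltn_eqF.
Qed.

Lemma gen_falling_free n (c d : nat -> R) :
  \sum_(k < n) c k *: gfX k = \sum_(k < n) d k *: gfX k ->
  forall k, (k < n)%N -> c k = d k.
Proof.
elim: n => // n IHn; rewrite !big_ord_recr /= => eq_cd.
have gn : (gfX n)`_n = 1.
  by have /monicP := gen_falling_monic n; rewrite /lead_coef size_gen_falling.
have cdn : c n = d n.
  have := congr1 (fun p : {poly R} => p`_n) eq_cd.
  rewrite !coefD !coefZ gn !mulr1.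
  by rewrite !(nth_default 0 (size_gen_falling_sum _ _)) !add0r.
move=> k; rewrite ltnS leq_eqVlt => /predU1P[->//|]; apply: IHn.
by move: eq_cd; rewrite cdn => /addIr.
Qed.

Lemma deg_stirling1_exists n : exists c : 'rV[R]_n.+1,
  falling ('X : {poly R}) n == \sum_(k < n.+1) c 0 k *: gfX k.
Proof.
have [c ->] := @gen_falling_span n.+1 (falling 'X n) (eq_leq (size_falling n)).
by exists (\row_k c k); apply/eqP/eq_bigr => k _; rewrite mxE.
Qed.

(* S_{1,lambda}(n, k): the k-th coordinate of (X)_n in the family of the
   (X)_{j,lambda}, j <= n; it is extended by 0 outside the range k <= n. *)
Definition deg_stirling1 n k : R :=
  if (k <= n)%N then xchoose (deg_stirling1_exists n) 0 (inord k) else 0.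

Lemma deg_stirling1E n :
  falling ('X : {poly R}) n = \sum_(k < n.+1) deg_stirling1 n k *: gfX k.
Proof.
rewrite {1}(eqP (xchooseP (deg_stirling1_exists n))).
apply: eq_bigr => k _.
by rewrite /deg_stirling1 -ltnS ltn_ord inord_val.
Qed.

Lemma deg_stirling1_unique n (c : nat -> R) :
  falling ('X : {poly R}) n = \sum_(k < n.+1) c k *: gfX k ->
  forall k, (k <= n)%N -> deg_stirling1 n k = c k.
Proof. by rewrite deg_stirling1E => /gen_falling_free. Qed.

End DegenerateStirling1.

(* Main.v *)
Require Import Defs.
From mathcomp Require Import all_boot all_order all_algebra.
From mathcomp Require Import reals.

(** Multiplication by [X - n] turns [(X)_n] into [(X)_(n+1)], while multiplication
    by [X - k lambda] turns [(X)_(k,lambda)] into [(X)_(k+1,lambda)].  Writing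
    [X - n = (X - k lambda) + (k lambda - n)] on each term of the expansion of
    [(X)_n] and comparing coordinates gives the triangular recurrence
    [deg_stirling1_rec]:
      [S(n+1, m+1) = S(n, m) + ((m+1) lambda - n) S(n, m+1)].
    For fixed [m] this is a first-order linear recurrence in [n] for the column
    [S(-, m+1)], with source term [S(-, m)] and zero initial value.  Unrolling it,
    the source [S(l, m)] reaches [S(k+1, m+1)] through the multipliers
    [(m+1) lambda - j] for [l < j <= k], whose product is
    [(-1)^(k-l) (k - (m+1) lambda)_(k-l)]. *)

Import Order.TTheory GRing.Theory Num.Theory.
Local Open Scope ring_scope.

Lemma fallingS (A : comNzRingType) (x : A) n :
  falling x n.+1 = falling x n * (x - n%:R).
Proof. exact: big_ord_recr. Qed.

Lemma gen_fallingS (A : comNzRingType) (lambda x : A) n :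
  gen_falling lambda x n.+1 = gen_falling lambda x n * (x - n%:R * lambda).
Proof. exact: big_ord_recr. Qed.

(** Removing the first factor of a falling factorial, rather than the last,
    shifts its argument: this is how the coefficients evolve with [k]. *)
Lemma falling_shift (A : comNzRingType) (x : A) n :
  falling x n.+1 = x * falling (x - 1) n.
Proof.
rewrite /falling big_ord_recl subr0; congr (_ * _).
by apply: eq_bigr => i _; rewrite lift0 -addn1 natrD opprD addrA addrAC.
Qed.

Section Recurrence.
Variables (R : comNzRingType) (lambda : R).

Lemma deg_stirling1_gt n k : (n < k)%N -> deg_stirling1 lambda n k = 0.
Proof. by rewrite /deg_stirling1 ltnNge => /negPf->. Qed.

Lemma gen_falling_mulXsubn n k :
  gen_falling lambda%:P ('X : {poly R}) k * ('X - n%:R) =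
  gen_falling lambda%:P 'X k.+1
    + (k%:R * lambda - n%:R) *: gen_falling lambda%:P 'X k.
Proof.
rewrite gen_fallingS -mul_polyC polyCB polyCM !polyC_natr.
by rewrite [_ * gen_falling _ _ _]mulrC -mulrDr addrA subrK.
Qed.

(** Both sides are coordinates of [(X)_n (X - n)] in the basis of generalized
    falling factorials.  Extending the numbers by [0] beyond the diagonal makes
    the relation hold for all indices. *)
Lemma deg_stirling1_rec n k :
  deg_stirling1 lambda n.+1 k.+1 =
  deg_stirling1 lambda n k
    + (k.+1%:R * lambda - n%:R) * deg_stirling1 lambda n k.+1.
Proof.
have [lt_nk | le_kn] := ltnP n k.
  by rewrite !deg_stirling1_gt ?mulr0 ?addr0 // ltnW.
pose c j := (if j is i.+1 then deg_stirling1 lambda n i else 0)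
  + deg_stirling1 lambda n j * (j%:R * lambda - n%:R).
rewrite [_ * deg_stirling1 lambda n k.+1]mulrC.
apply: (@deg_stirling1_unique _ lambda n.+1 c) => //.
rewrite fallingS (deg_stirling1E lambda) mulr_suml.
under eq_bigr => i _ do
  rewrite -scalerAl gen_falling_mulXsubn scalerDr scalerA.
under [RHS]eq_bigr => i _ do rewrite scalerDl.
rewrite !big_split /=; congr (_ + _).
  (* the shifted part has no coordinate of index 0 *)
  by rewrite [RHS]big_ord_recl scale0r add0r.
(* the diagonal part has no coordinate of index n+1 *)
by rewrite [RHS]big_ord_recr /= deg_stirling1_gt // mul0r scale0r addr0.
Qed.

End Recurrence.

Theorem theorem8 (R : realType) (lambda : R) (m k : nat) (hmk : (m <= k)%N) :
  deg_stirling1 lambda k.+1 m.+1 =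
  \sum_(m <= l < k.+1)
     (-1) ^+ (k - l) * falling (k%:R - m.+1%:R * lambda) (k - l)
       * deg_stirling1 lambda l m.
Proof.
have top_coef (x y : R) n : (-1) ^+ (n - n) * falling x (n - n) * y = y.
  by rewrite subnn /falling big_ord0 !mul1r.
(* In both cases the recurrence accounts for the top term of the sum. *)
elim: k hmk => [|k IHk] le_mk;
  rewrite deg_stirling1_rec big_nat_recr //= top_coef addrC;
  congr (_ + _).
  by rewrite big_geq // deg_stirling1_gt ?mulr0.
move: le_mk; rewrite leq_eqVlt => /predU1P[<- | le_mk].
  by rewrite big_geq // deg_stirling1_gt ?mulr0.
rewrite IHk // mulr_sumr; apply: eq_big_nat => l /andP[_ lt_lk].
rewrite subSn // exprS falling_shift.
have -> : k.+1%:R - m.+1%:R * lambda - 1 = k%:R - m.+1%:R * lambda.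
  by rewrite -addn1 natrD addrAC addrK.
by rewrite -opprB mulN1r !mulNr !mulrA [_ * (-1) ^+ _]mulrC.
Qed.
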